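(* Let $E$ be a row-finite directed graph in which every cycle has an exit, and let $A$ be an arbitrary $\mathbb{B}$-algebra over the Boolean semifield $\mathbb{B}$. If $\phi\colon L_{\mathbb{B}}(E)\to A$ is a hemiring homomorphism with $\phi(v)\neq0$ for all $v\in E^0$, then $\phi$ is injective.
   Context: The Boolean semifield is $\mathbb{B}=(\{0,1\},\vee,\wedge,0,1)$. A $\mathbb{B}$-algebra is a $\mathbb{B}$-semimodule (commutative monoid with unital $\mathbb{B}$-action, so idempotent addition) with an associative bilinear multiplication, not necessarily unital. A hemiring homomorphism is a map preserving $0$, $+$ and multiplication. A directed graph $E=(E^0,E^1,s,r)$ has disjoint sets $E^0$ of vertices, $E^1$ of edges and maps $s,r\colon E^1\to E^0$. It is row-finite if $|s^{-1}(v)|<\infty$ for all $v\in E^0$. A vertex $v$ is regular if $0<|s^{-1}(v)|<\infty$. A cycle is a sequence $e_1\dots e_n$ of edges with $n\ge1$, $r(e_i)=s(e_{i+1})$ for $1\le i\le n-1$, $r(e_n)=s(e_1)$, and $s(e_1),\dots,s(e_n)$ distinct. An exit for it is an edge $f$ with $s(f)=s(e_i)$ and $f\neq e_i$ for some $i$. $L_{\mathbb{B}}(E)$ (the Leavitt path algebra) is the (not necessarily unital) $\mathbb{B}$-algebra generated by $E^0\cup E^1\cup\{e^*\mid e\in E^1\}$ subject to: (1) $vw=\delta_{v,w}v$ for $v,w\in E^0$; (2) $s(e)e=e=er(e)$ and $r(e)e^*=e^*=e^*s(e)$ for $e\in E^1$; (3) $e^*f=\delta_{e,f}r(e)$ for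 $e,f\in E^1$; (4) $v=\sum_{e\in s^{-1}(v)}ee^*$ for every regular vertex $v$. That is, it is the quotient of the free $\mathbb{B}$-algebra on these generators by the congruence generated by these relations. *)

(* Defs.v *)
From HB Require Import structures.
From mathcomp Require Import all_boot all_order all_algebra finmap.
From mathcomp Require Import boolp classical_sets functions cardinality.

Set Implicit Arguments.
Unset Strict Implicit.
Unset Printing Implicit Defensive.

Import GRing.Theory.

Local Open Scope fset_scope.
Local Open Scope ring_scope.

(* Not bool itself, which MathComp makes the ring of integers modulo 2.       *)
Variant boolsf := B0 | B1.

Definition bool_of_boolsf (k : boolsf) : bool := if k is B1 then true else false.
Definition boolsf_of_bool (b : bool) : boolsf := if b then B1 else B0.
Lemma bool_of_boolsfK : cancel bool_of_boolsf boolsf_of_bool.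
Proof. by case. Qed.
HB.instance Definition _ := Choice.copy boolsf (can_type bool_of_boolsfK).

Definition boolsf_or (k l : boolsf) : boolsf := if k is B1 then B1 else l.
Definition boolsf_and (k l : boolsf) : boolsf := if k is B1 then l else B0.

Lemma boolsf_orA : associative boolsf_or. Proof. by do 3!case. Qed.
Lemma boolsf_orC : commutative boolsf_or. Proof. by do 2!case. Qed.
Lemma boolsf_or0 : left_id B0 boolsf_or. Proof. by []. Qed.
HB.instance Definition _ := GRing.isNmodule.Build boolsf
  boolsf_orA boolsf_orC boolsf_or0.

Lemma boolsf_andA : associative boolsf_and. Proof. by do 3!case. Qed.
Lemma boolsf_andC : commutative boolsf_and. Proof. by do 2!case. Qed.
Lemma boolsf_and1 : left_id B1 boolsf_and. Proof. by []. Qed.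
Lemma boolsf_andDl : left_distributive boolsf_and boolsf_or.
Proof. by do 3!case. Qed.
Lemma boolsf_and0 : left_zero B0 boolsf_and. Proof. by []. Qed.
Lemma boolsf_nonzero : B1 != B0. Proof. by []. Qed.
HB.instance Definition _ := GRing.Nmodule_isComNzSemiRing.Build boolsf
  boolsf_andA boolsf_andC boolsf_and1 boolsf_andDl boolsf_and0 boolsf_nonzero.

(* B-algebras. The associative, not necessarily unital, multiplication is     *)
(* that of a semigroupType, written ( _ * _ )%g. Bilinearity makes 0          *)
(* absorbing, since 0 = 0 *: x.                                               *)
HB.mixin Record isBAlgebra A of GRing.LSemiModule boolsf A & Semigroup A := {
  bmulDl : forall x y z : A, ((x + y)%R * z)%g = (x * z)%g + (y * z)%g ;
  bmulDr : forall x y z : A, (x * (y + z)%R)%g = (x * y)%g + (x * z)%g ;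
  bscaleAl : forall (k : boolsf) (x y : A), k *: (x * y)%g = ((k *: x)%R * y)%g ;
  bscaleAr : forall (k : boolsf) (x y : A), k *: (x * y)%g = (x * (k *: y)%R)%g
}.

#[short(type="bAlgType")]
HB.structure Definition BAlgebra :=
  {A of isBAlgebra A & GRing.LSemiModule boolsf A & Semigroup A}.

(* nmod_morphism f says that f preserves 0 and +.                             *)
Definition hemiring_morphism (A B : bAlgType) (f : A -> B) : Prop :=
  nmod_morphism f /\ {morph f : x y / (x * y)%g}.

Section FreeAlgebra.
Variable X : choiceType.

Record word := Word { letters :> seq X; _ : letters != [::] }.
HB.instance Definition _ := [isSub for letters].
HB.instance Definition _ := [Choice of word by <:].

Lemma catw_subproof (u v : word) : (u : seq X) ++ v != [::].
Proof. by case: u => -[]. Qed.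
Definition catw (u v : word) : word := Word (catw_subproof u v).

Lemma catwA : associative catw.
Proof. by move=> u v w; apply: val_inj; rewrite /= catA. Qed.

Definition letter (x : X) : word := @Word [:: x] isT.

(* Since addition is idempotent, an element of the free B-algebra on X is a   *)
(* finite sum of distinct nonempty words, i.e. a finite set of such words.    *)
Definition freeB : Type := {fset word}.
HB.instance Definition _ := Choice.on freeB.

Definition freeB_gen (x : X) : freeB := [fset letter x].
Definition freeB_mul (a b : freeB) : freeB :=
  [fset catw u v | u in a, v in b].
Definition freeB_scale (k : boolsf) (a : freeB) : freeB :=
  if k is B1 then a else fset0.

Lemma freeB_mulP (a b : freeB) w :
  reflect (exists u v, [/\ u \in a, v \in b & w = catw u v])
          (w \in freeB_mul a b).
Proof.
apply: (iffP idP) => [/imfset2P[u /= ua [v /= vb ->]]|[u [v [ua vb ->]]]].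
  by exists u, v.
by apply/imfset2P; exists u => //; exists v.
Qed.

Lemma freeB_mulA : associative freeB_mul.
Proof.
move=> a b c; apply/fsetP => w; apply/freeB_mulP/freeB_mulP.
  move=> [u [_ [ua /freeB_mulP[v [t [vb tc ->]]] ->]]].
  exists (catw u v), t; split => //; last by rewrite catwA.
  by apply/freeB_mulP; exists u, v.
move=> [_ [t [/freeB_mulP[u [v [ua vb ->]]] tc ->]]].
exists u, (catw v t); split => //; last by rewrite -catwA.
by apply/freeB_mulP; exists v, t.
Qed.

HB.instance Definition _ := GRing.isNmodule.Build freeB
  (@fsetUA _) (@fsetUC _) (@fset0U _).

Lemma freeB_scaleA (k l : boolsf) (a : freeB) :
  freeB_scale k (freeB_scale l a) = freeB_scale (k * l) a.
Proof. by case: k l => -[]. Qed.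
Lemma freeB_scale0 (a : freeB) : freeB_scale 0 a = 0. Proof. by []. Qed.
Lemma freeB_scale1 : left_id 1 freeB_scale. Proof. by []. Qed.
Lemma freeB_scaleDr : right_distributive freeB_scale +%R.
Proof. by case=> // a b; rewrite /freeB_scale addr0. Qed.
Lemma freeB_scaleDl (a : freeB) :
  {morph freeB_scale^~ a : k l / k + l}.
Proof.
by case=> -[]; rewrite /freeB_scale /= ?add0r ?addr0 //; apply/esym/fsetUid.
Qed.

HB.instance Definition _ := GRing.Nmodule_isLSemiModule.Build boolsf freeB
  freeB_scaleA freeB_scale0 freeB_scale1 freeB_scaleDr freeB_scaleDl.
HB.instance Definition _ := isSemigroup.Build freeB freeB_mulA.

Lemma freeB_mulDl (a b c : freeB) : ((a + b)%R * c)%g = (a * c)%g + (b * c)%g.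
Proof.
apply/fsetP => w; apply/freeB_mulP/fsetUP.
  move=> [u [v [/fsetUP[ua|ub] vc ->]]]; [left|right];
  by apply/freeB_mulP; exists u, v.
by case=> /freeB_mulP[u [v [ua vc ->]]]; exists u, v; split => //;
  apply/fsetUP; [left|right].
Qed.
Lemma freeB_mulDr (a b c : freeB) : (a * (b + c)%R)%g = (a * b)%g + (a * c)%g.
Proof.
apply/fsetP => w; apply/freeB_mulP/fsetUP.
  move=> [u [v [ua /fsetUP[vb|vc] ->]]]; [left|right];
  by apply/freeB_mulP; exists u, v.
by case=> /freeB_mulP[u [v [ua vc ->]]]; exists u, v; split => //;
  apply/fsetUP; [left|right].
Qed.
Lemma freeB_scaleAl (k : boolsf) (x y : freeB) :
  k *: (x * y)%g = ((k *: x)%R * y)%g.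
Proof.
case: k => //; apply/esym/fsetP => w; rewrite in_fset0.
by apply/negP => /freeB_mulP[u [v []]]; rewrite in_fset0.
Qed.
Lemma freeB_scaleAr (k : boolsf) (x y : freeB) :
  k *: (x * y)%g = (x * (k *: y)%R)%g.
Proof.
case: k => //; apply/esym/fsetP => w; rewrite in_fset0.
by apply/negP => /freeB_mulP[u [v [_]]]; rewrite in_fset0.
Qed.

HB.instance Definition _ := isBAlgebra.Build freeB
  freeB_mulDl freeB_mulDr freeB_scaleAl freeB_scaleAr.

End FreeAlgebra.

Section Quotient.
Variables (A : bAlgType) (R : A -> A -> Prop).

Inductive cong : A -> A -> Prop :=
| cong_base x y : R x y -> cong x y
| cong_refl x : cong x x
| cong_sym x y : cong x y -> cong y x
| cong_trans y x z : cong x y -> cong y z -> cong x z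
| cong_add x x' y y' : cong x x' -> cong y y' -> cong (x + y) (x' + y')
| cong_mul x x' y y' : cong x x' -> cong y y' -> cong (x * y)%g (x' * y')%g
| cong_scale (k : boolsf) x x' : cong x x' -> cong (k *: x) (k *: x').

Definition congb : rel A := fun x y => `[< cong x y >].

Lemma congb_refl : reflexive congb.
Proof. by move=> x; apply/asboolP/cong_refl. Qed.
Lemma congb_sym : symmetric congb.
Proof. by move=> x y; apply/asboolP/asboolP => /cong_sym. Qed.
Lemma congb_trans : transitive congb.
Proof.
by move=> y x z /asboolP xy /asboolP yz; apply/asboolP/(cong_trans xy).
Qed.

Canonical congb_equiv := EquivRel congb congb_refl congb_sym congb_trans.

Definition quotB : Type := {eq_quot congb}%qT.
HB.instance Definition _ := Choice.on quotB.
HB.instance Definition _ := Quotient.on quotB.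
HB.instance Definition _ := EqQuotient.on quotB.

Definition quotB_pi (x : A) : quotB := \pi_(quotB)%qT x.

Lemma quotB_piP x y : quotB_pi x = quotB_pi y <-> cong x y.
Proof.
split=> [/eqP|xy]; first by rewrite /quotB_pi eqmodE => /asboolP.
by apply/eqP; rewrite /quotB_pi eqmodE; apply/asboolP.
Qed.

Lemma cong_repr x : cong (repr (quotB_pi x)) x.
Proof. by apply/quotB_piP; rewrite /quotB_pi reprK. Qed.

Lemma quotB_ind (P : quotB -> Prop) : (forall x, P (quotB_pi x)) -> forall q, P q.
Proof. by move=> Ppi q; rewrite -(reprK q); apply: Ppi. Qed.

Definition quotB_add (p q : quotB) : quotB := quotB_pi (repr p + repr q).
Definition quotB_mul (p q : quotB) : quotB := quotB_pi (repr p * repr q)%g.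
Definition quotB_scale (k : boolsf) (q : quotB) : quotB :=
  quotB_pi (k *: repr q).

Lemma quotB_addE x y : quotB_add (quotB_pi x) (quotB_pi y) = quotB_pi (x + y).
Proof. by apply/quotB_piP/cong_add; apply: cong_repr. Qed.
Lemma quotB_mulE x y :
  quotB_mul (quotB_pi x) (quotB_pi y) = quotB_pi (x * y)%g.
Proof. by apply/quotB_piP/cong_mul; apply: cong_repr. Qed.
Lemma quotB_scaleE k x : quotB_scale k (quotB_pi x) = quotB_pi (k *: x).
Proof. by apply/quotB_piP/cong_scale/cong_repr. Qed.

Lemma quotB_addA : associative quotB_add.
Proof.
by do 3![elim/quotB_ind => ?]; rewrite !quotB_addE addrA.
Qed.
Lemma quotB_addC : commutative quotB_add.
Proof. by do 2![elim/quotB_ind => ?]; rewrite !quotB_addE addrC. Qed.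
Lemma quotB_add0 : left_id (quotB_pi 0) quotB_add.
Proof. by elim/quotB_ind => ?; rewrite quotB_addE add0r. Qed.

HB.instance Definition _ := GRing.isNmodule.Build quotB
  quotB_addA quotB_addC quotB_add0.

Lemma quotB_scaleA (k l : boolsf) (q : quotB) :
  quotB_scale k (quotB_scale l q) = quotB_scale (k * l) q.
Proof. by elim/quotB_ind: q => ?; rewrite !quotB_scaleE scalerA. Qed.
Lemma quotB_scale0 (q : quotB) : quotB_scale 0 q = 0.
Proof. by elim/quotB_ind: q => ?; rewrite quotB_scaleE scale0r. Qed.
Lemma quotB_scale1 : left_id 1 quotB_scale.
Proof. by elim/quotB_ind => ?; rewrite quotB_scaleE scale1r. Qed.
Lemma quotB_scaleDr : right_distributive quotB_scale +%R.
Proof.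
move=> k; do 2![elim/quotB_ind => ?].
by rewrite [X in quotB_scale _ X]quotB_addE !quotB_scaleE [RHS]quotB_addE scalerDr.
Qed.
Lemma quotB_scaleDl (q : quotB) : {morph quotB_scale^~ q : k l / k + l}.
Proof.
move=> k l; elim/quotB_ind: q => ?.
by rewrite !quotB_scaleE [RHS]quotB_addE scalerDl.
Qed.

HB.instance Definition _ := GRing.Nmodule_isLSemiModule.Build boolsf quotB
  quotB_scaleA quotB_scale0 quotB_scale1 quotB_scaleDr quotB_scaleDl.

Lemma quotB_mulA : associative quotB_mul.
Proof.
by do 3![elim/quotB_ind => ?]; rewrite !quotB_mulE mulgA.
Qed.

HB.instance Definition _ := isSemigroup.Build quotB quotB_mulA.

Lemma quotB_piD : {morph quotB_pi : x y / x + y}.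
Proof. by move=> x y; rewrite [RHS]quotB_addE. Qed.
Lemma quotB_piM : {morph quotB_pi : x y / (x * y)%g}.
Proof. by move=> x y; rewrite [RHS]quotB_mulE. Qed.
Lemma quotB_piZ (k : boolsf) : {morph quotB_pi : x / k *: x}.
Proof. by move=> x; rewrite [RHS]quotB_scaleE. Qed.

Lemma quotB_mulDl (a b c : quotB) : ((a + b)%R * c)%g = (a * c)%g + (b * c)%g.
Proof.
elim/quotB_ind: a => a; elim/quotB_ind: b => b; elim/quotB_ind: c => c.
by rewrite -[in LHS]quotB_piD -!quotB_piM -[RHS]quotB_piD bmulDl.
Qed.
Lemma quotB_mulDr (a b c : quotB) : (a * (b + c)%R)%g = (a * b)%g + (a * c)%g.
Proof.
elim/quotB_ind: a => a; elim/quotB_ind: b => b; elim/quotB_ind: c => c.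
by rewrite -[in LHS]quotB_piD -!quotB_piM -[RHS]quotB_piD bmulDr.
Qed.
Lemma quotB_scaleAl (k : boolsf) (x y : quotB) :
  k *: (x * y)%g = ((k *: x)%R * y)%g.
Proof.
elim/quotB_ind: x => x; elim/quotB_ind: y => y.
by rewrite -[in LHS]quotB_piM -[LHS]quotB_piZ -[in RHS]quotB_piZ -quotB_piM bscaleAl.
Qed.
Lemma quotB_scaleAr (k : boolsf) (x y : quotB) :
  k *: (x * y)%g = (x * (k *: y)%R)%g.
Proof.
elim/quotB_ind: x => x; elim/quotB_ind: y => y.
by rewrite -[in LHS]quotB_piM -[LHS]quotB_piZ -[in RHS]quotB_piZ -quotB_piM bscaleAr.
Qed.

HB.instance Definition _ := isBAlgebra.Build quotB
  quotB_mulDl quotB_mulDr quotB_scaleAl quotB_scaleAr.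

End Quotient.

Record digraph := Digraph {
  vertex : choiceType;
  edge : choiceType;
  src : edge -> vertex;
  rng : edge -> vertex
}.

Section Digraph.
Variable E : digraph.

Definition out_edges (v : vertex E) : set (edge E) :=
  [set e | src e = v]%classic.

Definition row_finite : Prop := forall v, finite_set (out_edges v).

Definition regular (v : vertex E) : Prop :=
  (out_edges v !=set0)%classic /\ finite_set (out_edges v).

(* [path.cycle] includes the condition from the last edge back to the first.  *)
Definition graph_cycle (c : seq (edge E)) : Prop :=
  [/\ c != [::], cycle (fun e f => rng e == src f) c & uniq (map (@src E) c)].

Definition exit_of (c : seq (edge E)) (f : edge E) : Prop :=
  exists e, [/\ e \in c, src f = src e & f <> e].

End Digraph.

Section Leavitt.
Variable E : digraph.

Inductive leavitt_gen :=
| Vertex of vertex E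
| Edge of edge E
| Ghost of edge E.

Definition leavitt_gen_encode (g : leavitt_gen) : vertex E + (edge E + edge E) :=
  match g with
  | Vertex v => inl v
  | Edge e => inr (inl e)
  | Ghost e => inr (inr e)
  end.
Definition leavitt_gen_decode (s : vertex E + (edge E + edge E)) : leavitt_gen :=
  match s with
  | inl v => Vertex v
  | inr (inl e) => Edge e
  | inr (inr e) => Ghost e
  end.
Lemma leavitt_gen_encodeK : cancel leavitt_gen_encode leavitt_gen_decode.
Proof. by case. Qed.
HB.instance Definition _ := Choice.copy leavitt_gen (can_type leavitt_gen_encodeK).

Local Notation V v := (freeB_gen (Vertex v)).
Local Notation D e := (freeB_gen (Edge e)).
Local Notation G e := (freeB_gen (Ghost e)).

Inductive leavitt_rel : freeB leavitt_gen -> freeB leavitt_gen -> Prop :=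
| leavitt_vertices v w :
    leavitt_rel (V v * V w)%g (if v == w then V v else 0)
| leavitt_src_edge e : leavitt_rel (V (src e) * D e)%g (D e)
| leavitt_edge_rng e : leavitt_rel (D e * V (rng e))%g (D e)
| leavitt_rng_ghost e : leavitt_rel (V (rng e) * G e)%g (G e)
| leavitt_ghost_src e : leavitt_rel (G e * V (src e))%g (G e)
| leavitt_ghost_edge e f :
    leavitt_rel (G e * D f)%g (if e == f then V (rng e) else 0)
| leavitt_regular v : regular v ->
    leavitt_rel (V v) (\sum_(e <- fset_set (out_edges v)) (D e * G e)%g).

Definition leavitt : Type := quotB leavitt_rel.
HB.instance Definition _ := BAlgebra.on leavitt.

Definition leavitt_vertex (v : vertex E) : leavitt :=
  quotB_pi leavitt_rel (V v).

End Leavitt.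

(* Main.v *)
Require Import Defs.
From mathcomp Require Import all_boot all_order all_algebra finmap.
From mathcomp Require Import boolp classical_sets cardinality.

(** Addition in a B-algebra is idempotent, so [x <<= y := x + y = y] is a
    partial order, and a hemiring homomorphism is monotone. Injectivity of
    [phi] therefore follows once [phi] reflects the order: if
    [phi x <<= phi y] then [x <<= y] (lemma [phi_ble]).

    Write [p] and [p^*] for the elements attached to a walk [p] and to its
    ghost. The algebra is additively spanned by the monomials [p q^*], with
    [p] and [q] ending at the same vertex, so [x] may be taken to be such a
    monomial. Multiplying by [p^*] on the left and by [q] on the right turns
    it into the vertex [v] where [p] and [q] end. No information is lost:
    row-finiteness gives [p p^* <<= s(p)] (lemma [ble_path_ghost]), so
    [p (p^* y q) q^* <<= y]. It remains to treat [x = v] (lemma [vertex_ble]).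

    By row-finiteness, the relation at regular vertices, applied repeatedly,
    expands [v] as the sum of the [s s^*] over the walks [s] from [v] that
    end at a sink or have a fixed length, chosen at least as long as every
    walk in the monomials of [y]. Compress the inequality by such an [s],
    that is, replace [y] by [s^* y s]. A monomial [p q^*] of [y]
    survives only if [p] and [q] are prefixes of [s], and then there are
    two cases (lemma [ghost_monomial_path]). Either
    [p = q], and [s s^* <<= p p^* <<= y], as desired; or [s^* p q^* s] is a
    nonempty closed walk at the end [w] of [s], or the ghost of one.

    The second case cannot hold for all monomials at once. A closed walk
    [c] has an exit, so any walk from [w] can be extended to a walk [t] that
    leaves the periodic walk [c c c ...]; then [t^* c t = t^* c^* t = 0].
    Doing this for each closed walk in turn produces a single [t] that kills
    them all (lemma [compression_loops]). Compressing by it yields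
    [phi u <<= phi 0 = 0] for the end [u] of [t], against the hypothesis
    that [phi] does not vanish on vertices. *)

Set Implicit Arguments.
Unset Strict Implicit.
Unset Printing Implicit Defensive.

Import GRing.Theory.

Local Open Scope ring_scope.

Local Notation "x ** y" := (x * y)%g (at level 40, left associativity).

(** * The order of a B-algebra *)

Section BAlgebraOrder.
Variable A : bAlgType.
Implicit Types x y z : A.

Lemma mulb_mulA x y z t : x ** (y ** z) ** t = (x ** y) ** (z ** t).
Proof. by rewrite !mulgA. Qed.

Lemma mul0b x : 0 ** x = 0.
Proof. by rewrite -[X in X ** x](scale0r (0 : A)) -bscaleAl scale0r. Qed.

Lemma mulb0 x : x ** 0 = 0.
Proof. by rewrite -[X in _ ** X](scale0r (0 : A)) -bscaleAr scale0r. Qed.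

Lemma addbb x : x + x = x.
Proof. by rewrite -[x in LHS]scale1r -scalerDl scale1r. Qed.

Definition ble x y := x + y = y.
Local Notation "x <<= y" := (ble x y) (at level 70).

Lemma ble_refl x : x <<= x. Proof. exact: addbb. Qed.

Lemma ble0 x : 0 <<= x. Proof. exact: add0r. Qed.

Lemma bleb0 x : x <<= 0 -> x = 0. Proof. by rewrite /ble addr0. Qed.

Lemma ble_trans y x z : x <<= y -> y <<= z -> x <<= z.
Proof. by rewrite /ble => xy <-; rewrite addrA xy. Qed.

Lemma ble_anti x y : x <<= y -> y <<= x -> x = y.
Proof. by rewrite /ble => xy yx; rewrite -[LHS]yx addrC. Qed.

Lemma ble_add x y z : x <<= z -> y <<= z -> x + y <<= z.
Proof. by rewrite /ble => xz yz; rewrite -addrA yz xz. Qed.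

Lemma ble_mul2l z x y : x <<= y -> z ** x <<= z ** y.
Proof. by rewrite /ble -bmulDr => ->. Qed.

Lemma ble_mul2r z x y : x <<= y -> x ** z <<= y ** z.
Proof. by rewrite /ble -bmulDl => ->. Qed.

Lemma ble_sum (I : eqType) (r : seq I) (F : I -> A) y :
  (forall i, i \in r -> F i <<= y) -> \sum_(i <- r) F i <<= y.
Proof.
elim: r => [|i r IHr] Fy; first by rewrite big_nil; apply: ble0.
rewrite big_cons; apply: ble_add; first by apply: Fy; rewrite mem_head.
by apply: IHr => j jr; apply: Fy; rewrite inE jr orbT.
Qed.

Lemma ble_summand (I : eqType) (r : seq I) (F : I -> A) i :
  i \in r -> F i <<= \sum_(j <- r) F j.
Proof.
move=> /path.splitPr[r1 r2]; rewrite big_cat big_cons /ble /=.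
by rewrite (addrCA (F i)) (addrA (F i)) (addbb (F i)).
Qed.

Lemma mulb_sumr (I : Type) (r : seq I) (F : I -> A) x :
  x ** (\sum_(i <- r) F i) = \sum_(i <- r) x ** F i.
Proof. by apply: (big_morph (fun y => x ** y)); [exact: bmulDr|exact: mulb0]. Qed.

Lemma mulb_suml (I : Type) (r : seq I) (F : I -> A) x :
  (\sum_(i <- r) F i) ** x = \sum_(i <- r) F i ** x.
Proof.
apply: (big_morph (fun y => y ** x)); last exact: mul0b.
by move=> y z; apply: bmulDl.
Qed.

End BAlgebraOrder.

Local Notation "x <<= y" := (ble x y) (at level 70).

Section HemiringMorphism.
Variables (A B : bAlgType) (f : A -> B).
Hypothesis f_hom : hemiring_morphism f.

Lemma hemiring_morph0 : f 0 = 0. Proof. by case: f_hom => -[]. Qed.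

Lemma hemiring_morphD : {morph f : x y / x + y}.
Proof. by case: f_hom => -[]. Qed.

Lemma hemiring_morphM : {morph f : x y / x ** y}.
Proof. by case: f_hom => -[]. Qed.

Lemma hemiring_morph_ble x y : x <<= y -> f x <<= f y.
Proof. by rewrite /ble -hemiring_morphD => ->. Qed.

End HemiringMorphism.

(** * Walks and closed walks *)

Section Walks.
Variable E : digraph.
Implicit Types (u v w : vertex E) (e f : edge E) (s t c : seq (edge E)).

Fixpoint walk v s : bool :=
  if s is e :: s' then (src e == v) && walk (rng e) s' else true.

Definition walk_end v s := last v (map (@rng E) s).

Lemma walk_end_cat v s t : walk_end v (s ++ t) = walk_end (walk_end v s) t.
Proof. by rewrite /walk_end map_cat last_cat. Qed.

Lemma walk_cat v s t : walk v (s ++ t) = walk v s && walk (walk_end v s) t.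
Proof. by elim: s v => //= e s IHs v; rewrite IHs andbA. Qed.

Lemma walk_catl v s t : walk v (s ++ t) -> walk v s.
Proof. by rewrite walk_cat => /andP[]. Qed.

Lemma walk_catr v s t : walk v (s ++ t) -> walk (walk_end v s) t.
Proof. by rewrite walk_cat => /andP[]. Qed.

Lemma cat_injl r s t : s ++ r = t ++ r -> s = t.
Proof.
move=> st; have size_st : size s = size t.
  by apply/eqP; rewrite -(eqn_add2r (size r)) -!size_cat st.
by move/eqP: st; rewrite eqseq_cat // => /andP[/eqP].
Qed.

Definition loop w c := [/\ c != [::], walk w c & walk_end w c = w].

Lemma walk_path v e s :
  walk v (e :: s) = (src e == v) && path (fun e f => rng e == src f) e s.
Proof.
rewrite /=; congr (_ && _); elim: s e => //= f s IHs e.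
by rewrite IHs eq_sym.
Qed.

Lemma loop_cycle w c : loop w c -> path.cycle (fun e f => rng e == src f) c.
Proof.
case: c => [[]//|e c] [_]; rewrite walk_path => /andP[/eqP <- ec].
by rewrite /walk_end /= rcons_path last_map => ->; rewrite ec eqxx.
Qed.

Lemma not_uniq_map (U : eqType) (g : edge E -> U) s : ~~ uniq (map g s) ->
  exists s1 x s2 y s3, s = s1 ++ x :: s2 ++ y :: s3 /\ g x = g y.
Proof.
elim: s => //= x s IHs; rewrite negb_and negbK.
case: (boolP (g x \in _)) => [/mapP[y /path.splitPr[s2 s3] gxy] _|_ /= /IHs].
  by exists [::], x, s2, y, s3.
by move=> [s1 [y [s2 [z [s3 [-> gyz]]]]]]; exists (x :: s1), y, s2, z, s3.
Qed.

(** A closed walk contains a cycle: cut it at a repeated vertex until its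
    sources are distinct. Hence it inherits an exit from that cycle. *)
Lemma loop_exit :
  (forall c, graph_cycle c -> exists f, exit_of c f) ->
  forall w c, loop w c -> exists f, exit_of c f.
Proof.
move=> exits w c; have [n] := ubnP (size c); elim: n => // n IHn in w c *.
move=> size_c c_loop; have [c_uniq|] := boolP (uniq (map (@src E) c)).
  by apply: exits; split => //; [case: c_loop | apply: loop_cycle c_loop].
move=> /not_uniq_map[s1 [e [s2 [f [s3 [def_c ef]]]]]].
have [||g [e' [e's ge' gNe']]] := IHn (src e) (e :: s2).
- rewrite -ltnS; apply: leq_trans size_c; rewrite ltnS.
  by rewrite def_c size_cat /= size_cat ltn_addl // ltnS /= addnS leq_addr.
- case: c_loop => _; rewrite def_c => /walk_catr /= /andP[_].
  rewrite walk_cat => /andP[s2w /= /andP[/eqP fe _]] _.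
  by split=> //=; rewrite ?eqxx // ef.
exists g, e'; split=> //; move: e's.
by rewrite def_c !(inE, mem_cat) => /orP[]->; rewrite ?orbT.
Qed.

Lemma iter_catC n c : iter n (cat c) [::] ++ c = c ++ iter n (cat c) [::].
Proof. by elim: n => [|n IHn] /=; rewrite ?cats0 // -catA IHn. Qed.

Lemma loop_iter w c n : loop w c ->
  walk w (iter n (cat c) [::]) /\ walk_end w (iter n (cat c) [::]) = w.
Proof.
move=> [_ cw ce]; elim: n => //= n [IHw IHe].
by rewrite walk_cat walk_end_cat cw ce.
Qed.

(** The hypothesis says that [s] has period [c]: substituting [c ++ s] for its
    second occurrence [n] times makes [s] a prefix of [n] copies of [c]
    followed by [s]. *)
Lemma prefix_iter c s n : prefix s (c ++ s) -> (size s <= n)%N -> c != [::] ->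
  prefix s (iter n (cat c) [::]).
Proof.
move=> s_cs sn c0.
have {s_cs} : prefix s (iter n (cat c) [::] ++ s).
  elim: n {sn} => [|n IHn] /=; first exact: prefix_refl.
  apply: (prefix_trans s_cs); rewrite -catA.
  by rewrite prefix_catr // eqxx.
have size_iter : (size s <= size (iter n (cat c) [::]))%N.
  apply: leq_trans sn _; elim: n => //= n IHn.
  by rewrite size_cat -add1n leq_add // lt0n size_eq0.
by rewrite !prefixE takel_cat.
Qed.

End Walks.

(** * Spanning the Leavitt path algebra *)

Section LeavittAlgebra.
Variable E : digraph.
Implicit Types (u v w : vertex E) (e f : edge E) (s t c p q : seq (edge E)).

Local Notation L := (leavitt E).
Local Notation pi := (quotB_pi (@leavitt_rel E)).

Local Notation V := (@leavitt_vertex E).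
Definition leavitt_edge e : L := pi (freeB_gen (Edge e)).
Definition leavitt_ghost e : L := pi (freeB_gen (Ghost e)).
Local Notation D := leavitt_edge.
Local Notation G := leavitt_ghost.

Lemma leavitt_VV v w : V v ** V w = if v == w then V v else 0.
Proof.
transitivity (pi (if v == w then freeB_gen (Vertex v) else 0)); last by case: eqP.
rewrite -quotB_piM; apply/quotB_piP/cong_base/leavitt_vertices.
Qed.

Lemma leavitt_VVid v : V v ** V v = V v.
Proof. by rewrite leavitt_VV eqxx. Qed.

Lemma leavitt_VD e : V (src e) ** D e = D e.
Proof. by rewrite -quotB_piM; apply/quotB_piP/cong_base/leavitt_src_edge. Qed.

Lemma leavitt_DV e : D e ** V (rng e) = D e.
Proof. by rewrite -quotB_piM; apply/quotB_piP/cong_base/leavitt_edge_rng. Qed.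

Lemma leavitt_VG e : V (rng e) ** G e = G e.
Proof. by rewrite -quotB_piM; apply/quotB_piP/cong_base/leavitt_rng_ghost. Qed.

Lemma leavitt_GV e : G e ** V (src e) = G e.
Proof. by rewrite -quotB_piM; apply/quotB_piP/cong_base/leavitt_ghost_src. Qed.

Lemma leavitt_GD e f : G e ** D f = if e == f then V (rng e) else 0.
Proof.
transitivity (pi (if e == f then freeB_gen (Vertex (rng e)) else 0)); last by case: eqP.
rewrite -quotB_piM; apply/quotB_piP/cong_base/leavitt_ghost_edge.
Qed.

Lemma leavitt_V v : regular v ->
  V v = \sum_(e <- fset_set (out_edges v)) D e ** G e.
Proof.
move=> v_reg.
transitivity (pi (\sum_(e <- fset_set (out_edges v))
    (freeB_gen (Edge e) ** freeB_gen (Ghost e)))).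
  exact/quotB_piP/cong_base/leavitt_regular.
rewrite (big_morph pi (@quotB_piD _ _) (erefl _)).
by apply: eq_bigr => e _; rewrite quotB_piM.
Qed.

Fixpoint path_elt v s : L :=
  if s is e :: s' then D e ** path_elt (rng e) s' else V v.
Fixpoint ghost_elt v s : L :=
  if s is e :: s' then ghost_elt (rng e) s' ** G e else V v.

Lemma vertex_path u v s : walk v s ->
  V u ** path_elt v s = if u == v then path_elt v s else 0.
Proof.
case: s => [_|e s /= /andP[/eqP <- _]]; first by rewrite leavitt_VV; case: eqP => [->|].
rewrite -{1}leavitt_VD !mulgA leavitt_VV.
by case: eqP => [->|]; rewrite ?mul0b // leavitt_VD.
Qed.

Lemma ghost_vertex u v s : walk v s ->
  ghost_elt v s ** V u = if v == u then ghost_elt v s else 0.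
Proof.
case: s => [_|e s /= /andP[/eqP <- _]]; first by rewrite leavitt_VV.
rewrite -{1}leavitt_GV -!mulgA leavitt_VV.
by case: eqP => _; rewrite ?mulb0 // leavitt_GV.
Qed.

Lemma path_vertex v s : path_elt v s ** V (walk_end v s) = path_elt v s.
Proof.
elim: s v => [|e s IHs] v /=; first by rewrite leavitt_VVid.
by rewrite -mulgA [V _]/(V (walk_end (rng e) s)) IHs.
Qed.

Lemma vertex_ghost u v s :
  V u ** ghost_elt v s = if u == walk_end v s then ghost_elt v s else 0.
Proof.
elim: s v => [|e s IHs] v /=; first by rewrite leavitt_VV; case: eqP => [->|].
by rewrite mulgA IHs; case: eqP; rewrite // mul0b.
Qed.

Lemma path_cat v s t : walk (walk_end v s) t ->
  path_elt v (s ++ t) = path_elt v s ** path_elt (walk_end v s) t.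
Proof.
elim: s v => [|e s IHs] v t_walk /=; first by rewrite vertex_path ?eqxx.
by rewrite IHs // mulgA.
Qed.

Lemma ghost_cat v s t : walk (walk_end v s) t ->
  ghost_elt v (s ++ t) = ghost_elt (walk_end v s) t ** ghost_elt v s.
Proof.
elim: s v => [|e s IHs] v t_walk /=; first by rewrite ghost_vertex ?eqxx.
by rewrite IHs // mulgA.
Qed.

Variant ghost_path_spec v s u t : L -> Prop :=
| GhostPath0 : ghost_path_spec v s u t 0
| GhostPathPath t' of u = v & t = s ++ t' :
    ghost_path_spec v s u t (path_elt (walk_end v s) t')
| GhostPathGhost s' of u = v & s = t ++ s' :
    ghost_path_spec v s u t (ghost_elt (walk_end u t) s').

(** The relation between ghosts and edges cancels the two walks letter by
    letter: the product is zero unless one walk is a prefix of the other, and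
    then it is what is left of the longer one. *)
Lemma ghost_pathP v s u t : walk v s -> walk u t ->
  ghost_path_spec v s u t (ghost_elt v s ** path_elt u t).
Proof.
elim: s v u t => [|e s IHs] v u t.
  move=> _ ut; rewrite /= vertex_path //; case: eqP => [->|_]; last exact: GhostPath0.
  exact: (@GhostPathPath _ [::] _ t t).
move=> es; case: t => [_|f t].
  rewrite ghost_vertex //; case: eqP => [->|_]; last exact: GhostPath0.
  exact: (@GhostPathGhost _ (e :: s) _ [::] (e :: s)).
move: es => /= /andP[/eqP ev sw] /andP[/eqP fu tw].
rewrite -mulgA (mulgA (G e)) leavitt_GD; case: eqP => [ef|_]; last first.
  by rewrite mul0b mulb0; apply: GhostPath0.
rewrite -{f}ef in fu tw *.
rewrite vertex_path // eqxx.
case: (IHs (rng e) (rng e) t sw tw) => [|t' _ ->|s' _ ->]; first exact: GhostPath0.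
  by apply: (@GhostPathPath _ _ _ _ t'); rewrite // -ev.
by apply: (@GhostPathGhost _ _ _ _ s'); rewrite // -ev.
Qed.

Lemma ghost_path v s : walk v s -> ghost_elt v s ** path_elt v s = V (walk_end v s).
Proof.
elim: s v => [|e s IHs] v /=; first by rewrite leavitt_VVid.
move=> /andP[_ sw]; rewrite -mulgA (mulgA (G e)) leavitt_GD eqxx.
by rewrite vertex_path // eqxx IHs.
Qed.

(** The bound [n] on the lengths of both walks serves to choose walks at
    least as long as all those occurring in a given element. Zero is included so
    that products of monomials are monomials. *)
Inductive monomial n : L -> Prop :=
| Monomial0 : monomial n 0
| Monomial v p w q of walk v p & walk w q & walk_end v p = walk_end w q
    & (size p <= n)%N & (size q <= n)%N :
    monomial n (path_elt v p ** ghost_elt w q).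

Lemma monomialS n x : monomial n x -> monomial n.+1 x.
Proof.
by case=> [|v p w q pw qw pq pn qn]; [left|right] => //; apply: leqW.
Qed.

Lemma monomialW m n x : (m <= n)%N -> monomial m x -> monomial n x.
Proof. by move=> /subnK <-; elim: (n - m)%N => //= k IHk /IHk/monomialS. Qed.

Definition leavitt_gen_elt (g : leavitt_gen E) : L := pi (freeB_gen g).

Lemma monomial_gen g : monomial 1 (leavitt_gen_elt g).
Proof.
case: g => [v|e|e].
- rewrite (_ : leavitt_gen_elt _ = V v ** V v); last by rewrite leavitt_VVid.
  exact: (@Monomial 1 v [::] v [::]).
- rewrite (_ : leavitt_gen_elt _ = D e ** V (rng e) ** V (rng e));
    last by rewrite !leavitt_DV.
  by apply: (@Monomial 1 (src e) [:: e] (rng e) [::]) => //=; rewrite eqxx.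
- rewrite (_ : leavitt_gen_elt _ = V (rng e) ** (V (rng e) ** G e));
    last by rewrite !leavitt_VG.
  by apply: (@Monomial 1 (rng e) [::] (src e) [:: e]) => //=; rewrite eqxx.
Qed.

(** Only the product of a ghost [e^*] with [q^*], when the first walk is
    empty, is not immediate: when nonzero, it is the ghost of [q] followed
    by [e]. *)
Lemma monomial_mul n g x : monomial n x -> monomial n.+1 (leavitt_gen_elt g ** x).
Proof.
case=> [|v p w q pw qw pq pn qn]; first by rewrite mulb0; left.
rewrite mulgA; case: g => [u|e|e].
- change (leavitt_gen_elt _) with (V u); rewrite vertex_path //.
  case: eqP => _; last by rewrite mul0b; left.
  by apply: monomialS; right.
- change (leavitt_gen_elt _) with (D e).
  have -> : D e ** path_elt v p = if rng e == v then path_elt (src e) (e :: p) else 0.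
    rewrite -{1}leavitt_DV -mulgA vertex_path //.
    by case: eqP => [<-|_] //; rewrite mulb0.
  case: eqP => [ev|_]; last by rewrite mul0b; left.
  by right; rewrite // -?pq /walk_end /= ?eqxx ?ev //; apply: leqW.
change (leavitt_gen_elt _) with (G e); case: p => [|f p] in pw pq pn *.
  rewrite -mulgA vertex_ghost; case: eqP => [vq|_]; last by rewrite mulb0; left.
  rewrite -leavitt_GV -mulgA vertex_ghost; case: eqP => [ev|_];
    last by rewrite mulb0; left.
  have -> : G e ** ghost_elt w q = V (rng e) ** ghost_elt w (rcons q e).
    rewrite -cats1 ghost_cat /=; last by rewrite ev eqxx.
    by rewrite leavitt_VG mulgA leavitt_VG.
  apply: (@Monomial _ (rng e) [::]) => //; rewrite ?size_rcons // -cats1.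
    by rewrite walk_cat qw /= ev eqxx.
  by rewrite walk_end_cat.
rewrite /= mulgA leavitt_GD; case: eqP => [ef|_]; last by rewrite !mul0b; left.
rewrite -{f}ef in pw pq pn *; move: pw => /= /andP[ev pw].
rewrite vertex_path // eqxx; right => //; last exact: leqW.
by apply/leqW/ltnW.
Qed.

Definition spanned x := exists n (l : seq L),
  (forall m, m \in l -> monomial n m) /\ x = \sum_(m <- l) m.

Lemma spanned0 : spanned 0.
Proof. by exists 0%N, [::]; rewrite big_nil. Qed.

Lemma spannedD x y : spanned x -> spanned y -> spanned (x + y).
Proof.
move=> [m [l [lm ->]]] [n [k [kn ->]]]; exists (maxn m n), (l ++ k).
split=> [z|]; last by rewrite big_cat.
by rewrite mem_cat => /orP[/lm|/kn]; apply: monomialW; rewrite ?leq_maxl ?leq_maxr.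
Qed.

Lemma spannedM g x : spanned x -> spanned (leavitt_gen_elt g ** x).
Proof.
move=> [n [l [ln ->]]]; exists n.+1, [seq leavitt_gen_elt g ** m | m <- l].
split=> [_ /mapP[m /ln mn ->]|]; first exact: monomial_mul.
by rewrite big_map mulb_sumr.
Qed.

Lemma spanned_word (w : word (leavitt_gen E)) : spanned (pi [fset w]%fset).
Proof.
case: w => -[//|g s] gs; elim: s => [|h s IHs] in g gs *.
  exists 1%N, [:: leavitt_gen_elt g]; split=> [m|].
    by rewrite inE => /eqP ->; apply: monomial_gen.
  by rewrite big_seq1; congr (pi [fset _]%fset); apply: val_inj.
have -> : [fset Word gs]%fset =
    (freeB_gen g ** ([fset @Word _ (h :: s) isT]%fset : freeB (leavitt_gen E))).
  apply/fsetP => w; rewrite inE; apply/eqP/freeB_mulP.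
    move=> ->; exists (letter g), (@Word _ (h :: s) isT).
    by rewrite !inE; split=> //; apply: val_inj.
  by move=> [_ [_ [/fset1P-> /fset1P-> ->]]]; apply: val_inj.
by rewrite quotB_piM; apply/spannedM/IHs.
Qed.

Lemma leavitt_spanned x : spanned x.
Proof.
elim/quotB_ind: x => a.
have -> : pi a = \sum_(w <- (a : {fset word (leavitt_gen E)})) pi [fset w]%fset.
  rewrite -(big_morph pi (@quotB_piD _ _) (erefl _)); congr pi.
  apply/fsetP => w; rewrite -[w \in a]/(w \in enum_fset a).
  elim: (enum_fset a) => [|u s IHs]; first by rewrite big_nil.
  by rewrite big_cons inE [RHS]in_fsetU in_fset1 IHs.
elim: (X in \sum_(w <- X) _) => [|w s IHs]; first by rewrite big_nil; apply: spanned0.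
by rewrite big_cons; apply: spannedD => //; apply: spanned_word.
Qed.

(** Without a unit, vertices act as local projections: [v] keeps or deletes
    each monomial of [x]. *)
Lemma ble_vertex_mul v x : V v ** x <<= x.
Proof.
have [n [l [ln ->]]] := leavitt_spanned x; rewrite mulb_sumr; apply: ble_sum => m ml.
apply: ble_trans (ble_summand _ ml); case: (ln m ml) => [|u p w q pw _ _ _ _].
  by rewrite mulb0; apply: ble_refl.
rewrite mulgA vertex_path //; case: eqP => _; first exact: ble_refl.
by rewrite mul0b; apply: ble0.
Qed.

Lemma ble_mul_vertex v x : x ** V v <<= x.
Proof.
have [n [l [ln ->]]] := leavitt_spanned x; rewrite mulb_suml; apply: ble_sum => m ml.
apply: ble_trans (ble_summand _ ml); case: (ln m ml) => [|u p w q _ qw _ _ _].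
  by rewrite mul0b; apply: ble_refl.
rewrite -mulgA ghost_vertex //; case: eqP => _; first exact: ble_refl.
by rewrite mulb0; apply: ble0.
Qed.

(** * Compression by a walk *)

Definition compression v s x := ghost_elt v s ** x ** path_elt v s.

Lemma compression0 v s : compression v s 0 = 0.
Proof. by rewrite /compression mulb0 mul0b. Qed.

Lemma compression_sum v s (I : Type) (r : seq I) (F : I -> L) :
  compression v s (\sum_(i <- r) F i) = \sum_(i <- r) compression v s (F i).
Proof. by rewrite /compression mulb_sumr mulb_suml. Qed.

Lemma compression_cat v s t x : walk (walk_end v s) t ->
  compression v (s ++ t) x = compression (walk_end v s) t (compression v s x).
Proof. by move=> tw; rewrite /compression path_cat // ghost_cat // !mulgA. Qed.

Lemma compression_vertex v s : walk v s -> compression v s (V v) = V (walk_end v s).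
Proof.
by move=> sw; rewrite /compression -mulgA vertex_path // eqxx ghost_path.
Qed.

Section RowFinite.
Hypothesis E_row_finite : row_finite E.

(** As no vertex is an infinite emitter, [src e] is regular, and the product
    is a summand of its expansion. *)
Lemma ble_edge_ghost e : D e ** G e <<= V (src e).
Proof.
have e_out : e \in out_edges (src e) by rewrite inE.
rewrite leavitt_V; last by split=> //; exists e; apply: set_mem e_out.
by apply: (ble_summand (fun e => D e ** G e)); rewrite in_fset_set.
Qed.

Lemma ble_path_ghost v s : walk v s -> path_elt v s ** ghost_elt v s <<= V v.
Proof.
elim: s v => [|e s IHs] v /=; first by rewrite leavitt_VVid => _; apply: ble_refl.
move=> /andP[/eqP <- sw]; apply: ble_trans (ble_edge_ghost e).
have := ble_mul2r (G e) (ble_mul2l (D e) (IHs _ sw)).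
by rewrite leavitt_DV !mulgA.
Qed.

(** What the off-diagonal monomials become after compression. *)
Definition loop_elt w x :=
  x = 0 \/ exists2 c, loop w c & x = path_elt w c \/ x = ghost_elt w c.

(** The length condition says that no walk of the monomial can properly extend
    [s], so both are prefixes of [s] unless the compression vanishes. Writing
    [s = p ++ s1 = q ++ s2], the compression is [s1^* s2], where [s1] and
    [s2] are suffixes of the same walk: equal, or differing by a closed
    walk at the end of [s]. *)
Lemma ghost_monomial_path n v s x : walk v s -> monomial n x ->
    (n <= size s)%N \/ (forall e, src e <> walk_end v s) ->
  path_elt v s ** ghost_elt v s <<= x \/
  loop_elt (walk_end v s) (compression v s x).
Proof.
move=> sw [|a p b q pw qw pq pn qn s_long].
  by right; left; apply: compression0.
(* A walk of the monomial extending [s] equals [s]: a proper extension would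
   be too long, or would leave a sink. *)
have no_ext t r : (size t <= n)%N -> walk v t -> t = s ++ r -> r = [::].
  case: r => // e r tn tw def_t; case: s_long => [ns|/(_ e)[]].
    have := leq_trans tn ns; rewrite def_t size_cat /= addnS.
    by rewrite ltnNge leq_addr.
  by move: tw; rewrite def_t => /walk_catr /= /andP[/eqP].
rewrite /compression !mulgA.
have [sp0|[av [s1 def_s1 ->]]] : ghost_elt v s ** path_elt a p = 0 \/
    a = v /\ exists2 s1, s = p ++ s1 & ghost_elt v s ** path_elt a p =
      ghost_elt (walk_end v p) s1.
- case: ghost_pathP => // [|r av def_p|r <- ->]; [by left| |by right; split=> //; exists r].
  right; split=> //; rewrite {a}av in pw pq *; have r0 := no_ext _ _ pn pw def_p.
  by exists [::]; rewrite ?def_p r0 ?cats0.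
- by right; left; rewrite sp0 !mul0b.
have [qs0|[bv [s2 def_s2 qs]]] : ghost_elt b q ** path_elt v s = 0 \/
    b = v /\ exists2 s2, s = q ++ s2 & ghost_elt b q ** path_elt v s =
      path_elt (walk_end v q) s2.
- case: ghost_pathP => // [|r -> ->|r bv def_q]; [by left|by right; split=> //; exists r|].
  right; split=> //; rewrite -{b}bv in qw pq *; have r0 := no_ext _ _ qn qw def_q.
  by exists [::]; rewrite ?def_q r0 ?cats0.
- by right; left; rewrite -mulgA qs0 mulb0.
rewrite -mulgA qs; rewrite {a}av {b}bv in pw qw pq qs *.
have s1w : walk (walk_end v p) s1 by apply: walk_catr; rewrite -def_s1.
have s2w : walk (walk_end v q) s2 by apply: walk_catr; rewrite -def_s2.
have s1e : walk_end v s = walk_end (walk_end v p) s1 by rewrite def_s1 walk_end_cat.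
have s2e : walk_end v s = walk_end (walk_end v q) s2 by rewrite def_s2 walk_end_cat.
have diag : p = q -> path_elt v s ** ghost_elt v s <<= path_elt v p ** ghost_elt v q.
  move=> <-; rewrite def_s1 path_cat // ghost_cat //.
  have := ble_mul2r (ghost_elt v p) (ble_mul2l (path_elt v p) (ble_path_ghost s1w)).
  by rewrite path_vertex !mulgA.
case: ghost_pathP => // [|r _ def_s|r _ def_s]; first by right; left.
- have [r0|r_neq0] := eqVneq r [::].
    by left; apply: diag; apply: (@cat_injl E s1); rewrite -def_s1 def_s2 def_s r0 cats0.
  right; right; exists r; last by left; rewrite s1e.
  split=> //; first by rewrite s1e; move: s2w; rewrite def_s -pq => /walk_catr.
  by rewrite {1}s1e -walk_end_cat -def_s pq -s2e.
- have [r0|r_neq0] := eqVneq r [::].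
    by left; apply: diag; apply: (@cat_injl E s2); rewrite -def_s2 def_s1 def_s r0 cats0.
  right; right; exists r; last by right; rewrite s2e.
  split=> //; first by rewrite s2e; move: s1w; rewrite def_s pq => /walk_catr.
  by rewrite {1}s2e -walk_end_cat -def_s -pq -s1e.
Qed.

End RowFinite.

(** * Killing closed walks *)

Section Exits.
Hypothesis E_exits : forall c, graph_cycle c -> exists f, exit_of c f.

(** If [s] still follows the periodic walk [c c c ...], continue along it to
    the end of a full period beyond [s], then on to an edge [e] of [c] that
    has an exit [f], and take [f] instead of [e]. *)
Lemma loop_escape w c s : loop w c -> walk w s ->
  exists t, walk w (s ++ t) /\ ~~ prefix (s ++ t) (c ++ s ++ t).
Proof.
move=> c_loop sw; have [c0 cw ce] := c_loop.
have [s_cs|s_Ncs] := boolP (prefix s (c ++ s)); last by exists [::]; rewrite !cats0.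
have [f [e [ec fe fNe]]] := loop_exit E_exits c_loop.
have [c1 [c2 def_c]] : exists c1 c2, c = c1 ++ e :: c2.
  by case/path.splitPr: ec => c1 c2; exists c1, c2.
(* [size s] periods suffice to contain [s], as [c] is nonempty. *)
have /prefixP[r def_r] := prefix_iter s_cs (leqnn _) c0.
have [iter_w iter_e] := loop_iter (size s) c_loop.
exists (r ++ rcons c1 f).
rewrite [s ++ _]catA -def_r; split.
  rewrite walk_cat iter_w iter_e /= -cats1 walk_cat; rewrite def_c in cw.
  by rewrite (walk_catl cw) /= fe; have /= /andP[-> _] := walk_catr cw.
rewrite catA -iter_catC -catA prefix_catr // eqxx /= def_c -cats1 -catA prefix_catr //.
by rewrite eqxx prefix_cons; case: eqP.
Qed.

Lemma ghost_path_incomparable v s u t : walk v s -> walk u t ->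
  ~~ prefix s t -> ~~ prefix t s -> ghost_elt v s ** path_elt u t = 0.
Proof.
move=> sw tw /prefixP s_t /prefixP t_s.
by case: ghost_pathP => // r _ def_r; [case: s_t | case: t_s]; exists r.
Qed.

(** For a walk [r] that is not a prefix of [c ++ r], the walks [r] and
    [c ++ r] are incomparable, hence [r^* c r = 0]; the ghost of [c] is
    killed for the same reason. *)
Lemma compression_loop w s x : loop_elt w x -> walk w s ->
  exists t, walk w (s ++ t) /\ compression w (s ++ t) x = 0.
Proof.
move=> [->|[c c_loop x_c]] sw; first by exists [::]; rewrite cats0 compression0.
have [t [st_w st_c]] := loop_escape c_loop sw; exists t; split=> //.
have [c0 cw ce] := c_loop; move: (s ++ t) st_w st_c => r rw r_c.
have cr_w : walk w (c ++ r) by rewrite walk_cat cw ce.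
have c_r : ~~ prefix (c ++ r) r.
  apply: contra c0 => /size_prefix; rewrite size_cat -size_eq0.
  by rewrite -[X in (_ <= X)%N]add0n leq_add2r leqn0.
case: x_c => ->; rewrite /compression.
  rewrite -mulgA -[X in path_elt X r]ce -path_cat ?ce //.
  exact: ghost_path_incomparable.
rewrite -[X in ghost_elt X r]ce -ghost_cat ?ce //.
exact: ghost_path_incomparable.
Qed.

(** Extending a walk preserves the compressions that already vanish, so the
    elements can be killed one after the other. *)
Lemma compression_loops w (l : seq L) : (forall x, x \in l -> loop_elt w x) ->
  exists s, walk w s /\ forall x, x \in l -> compression w s x = 0.
Proof.
elim: l => [|x l IHl] l_loop; first by exists [::].
have [y yl|s [sw sl]] := IHl; first by apply: l_loop; rewrite inE yl orbT.
have [t [st_w st_x]] := compression_loop (l_loop x (mem_head _ _)) sw.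
exists (s ++ t); split=> // y; rewrite inE => /predU1P[->//|yl].
by rewrite compression_cat ?sl ?compression0 ?(walk_catr st_w).
Qed.

End Exits.

(** * The homomorphism reflects the order *)

Section Injectivity.
Hypothesis E_row_finite : row_finite E.
Hypothesis E_exits : forall c, graph_cycle c -> exists f, exit_of c f.
Variables (A : bAlgType) (phi : L -> A).
Hypothesis phi_hom : hemiring_morphism phi.
Hypothesis phi_vertex : forall v, phi (V v) <> 0.

Lemma phi_mul_ble x y a b : phi x <<= phi y -> phi (a ** x ** b) <<= phi (a ** y ** b).
Proof. by move=> xy; rewrite !hemiring_morphM //; apply/ble_mul2r/ble_mul2l. Qed.

(** If no monomial of [y] dominates [s s^*], all of them compress to loops,
    which a further walk [t] kills; then [phi] vanishes at the end of [t]. *)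
Lemma long_path_ble v y n (l : seq L) s :
    phi (V v) <<= phi y -> (forall m, m \in l -> monomial n m) -> y = \sum_(m <- l) m ->
    walk v s -> (n <= size s)%N \/ (forall e, src e <> walk_end v s) ->
  path_elt v s ** ghost_elt v s <<= y.
Proof.
move=> vy ln def_y sw s_long.
have [[m ml s_m]|no_m] := EM (exists2 m, m \in l & path_elt v s ** ghost_elt v s <<= m).
  by rewrite def_y; apply: ble_trans s_m (ble_summand id ml).
have l_loop x : x \in [seq compression v s m | m <- l] -> loop_elt (walk_end v s) x.
  move=> /mapP[m ml ->].
  have [s_m|//] := ghost_monomial_path E_row_finite sw (ln m ml) s_long.
  by case: no_m; exists m.
have [t [tw t0]] := compression_loops E_exits l_loop.
case: (@phi_vertex (walk_end (walk_end v s) t)); apply: bleb0.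
rewrite -(hemiring_morph0 phi_hom) -(compression_vertex tw) -(compression_vertex sw).
suff <- : compression (walk_end v s) t (compression v s y) = 0.
  by do 2!apply: phi_mul_ble.
rewrite def_y !compression_sum big_seq; apply: big1 => m ml.
by apply: t0; apply: map_f.
Qed.

(** The vertex is expanded until every walk is at least as long as the walks
    in [y] or stops at a sink. *)
Lemma vertex_ble v y : phi (V v) <<= phi y -> V v <<= y.
Proof.
move=> vy; have [n [l [ln def_y]]] := leavitt_spanned y.
(* [k] counts the edges by which [s] may still have to be extended. *)
suff expand k s : walk v s -> (n <= size s + k)%N -> path_elt v s ** ghost_elt v s <<= y.
  by rewrite -leavitt_VVid; apply: (expand n [::]).
elim: k s => [|k IHk] s sw s_n.
  by apply: (long_path_ble vy ln) => //; left; rewrite addn0 in s_n.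
have [[e ew]|no_e] := EM (exists e, src e = walk_end v s); last first.
  by apply: (long_path_ble vy ln) => //; right=> e ew; apply: no_e; exists e.
rewrite -path_vertex leavitt_V; last by split=> //; exists e.
rewrite mulb_sumr mulb_suml; apply: ble_sum => f.
rewrite in_fset_set // inE /= => fw.
have f_walk : walk (walk_end v s) [:: f] by rewrite /= fw eqxx.
have -> : path_elt v s ** (D f ** G f) ** ghost_elt v s =
    path_elt v (s ++ [:: f]) ** ghost_elt v (s ++ [:: f]).
  have pf : path_elt (walk_end v s) [:: f] = D f by apply: leavitt_DV.
  have gf : ghost_elt (walk_end v s) [:: f] = G f by apply: leavitt_VG.
  by rewrite (path_cat f_walk) (ghost_cat f_walk) pf gf mulb_mulA.
by apply: IHk; rewrite ?walk_cat ?sw // size_cat addn1 addSnnS.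
Qed.

(** The passage to the vertex where [p] and [q] end is reversible, because
    [p p^*] and [q q^*] lie below vertices. *)
Lemma monomial_ble n x y : monomial n x -> phi x <<= phi y -> x <<= y.
Proof.
case=> [_|v p w q pw qw pq _ _ xy]; first exact: ble0.
have /vertex_ble uy : phi (V (walk_end v p)) <<= phi (ghost_elt v p ** y ** path_elt w q).
  have := phi_mul_ble (ghost_elt v p) (path_elt w q) xy.
  by rewrite mulgA ghost_path // -mulgA ghost_path // -pq leavitt_VVid.
have := ble_mul2r (ghost_elt w q) (ble_mul2l (path_elt v p) uy).
rewrite path_vertex => /ble_trans; apply.
have py := ble_trans (ble_mul2r y (ble_path_ghost E_row_finite pw)) (ble_vertex_mul v y).
have yq := ble_trans (ble_mul2l y (ble_path_ghost E_row_finite qw)) (ble_mul_vertex w y).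
by apply: ble_trans yq; rewrite !mulgA in py *; do 2!apply: ble_mul2r.
Qed.

Lemma phi_ble x y : phi x <<= phi y -> x <<= y.
Proof.
have [n [l [ln def_x]]] := leavitt_spanned x => xy.
rewrite def_x; apply: ble_sum => m ml; apply: (monomial_ble (ln m ml)).
apply: ble_trans xy; apply: hemiring_morph_ble => //.
by rewrite def_x; apply: (ble_summand id ml).
Qed.

End Injectivity.

End LeavittAlgebra.

Theorem corollary4p8 (E : digraph) (A : bAlgType) (phi : leavitt E -> A)
  (E_row_finite : row_finite E)
  (E_exits : forall c : seq (edge E), graph_cycle c -> exists f, exit_of c f)
  (phi_hom : hemiring_morphism phi)
  (phi_vertex : forall v : vertex E, phi (leavitt_vertex v) <> 0) :
  injective phi.
Proof.
by move=> x y xy; apply: ble_anti;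
  apply: (phi_ble E_row_finite E_exits phi_hom phi_vertex); rewrite xy; apply: ble_refl.
Qed.
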